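(* Let $\mathcal{H}$ be a complex separable Hilbert space, let $C$ be a conjugation on $\mathcal{H}$, and let $T$ be a $C$-selfadjoint operator in $\mathcal{H}$. Suppose $T=U|T|$ is the polar decomposition of $T$. Then there exists a partial conjugation $J$ on $\mathcal{H}$ such that $U=CJ$ and $J|T|=|T|J$.
   Context: Operators may be unbounded. A conjugation on $\mathcal{H}$ is an antilinear map $C:\mathcal{H}\to\mathcal{H}$ with $C^2=I$ and $\langle Cf,Cg\rangle=\langle g,f\rangle$ for all $f,g\in\mathcal{H}$. A densely defined operator $T$ in $\mathcal{H}$ is $C$-selfadjoint if $T=CT^*C$ (equality of operators, including domains); such $T$ is closed. In the polar decomposition $T=U|T|$, $|T|=(T^*T)^{1/2}$ and $U$ is the partial isometry with kernel $\ker T$ (initial space $\overline{\mathrm{ran}\,|T|}$). A partial conjugation is a bounded antilinear operator $J$ on $\mathcal{H}$ that maps $(\ker J)^\perp$ into itself and whose restriction to $(\ker J)^\perp$ is a conjugation on $(\ker J)^\perp$. The equality $J|T|=|T|J$ is an equality of operators with their natural domains. *)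

(* Defs.v *)
From HB Require Import structures.
From mathcomp Require Import all_boot all_order all_algebra sesquilinear.
From mathcomp Require Import all_classical all_reals all_analysis.
From mathcomp Require Import complex.

Set Implicit Arguments.
Unset Strict Implicit.
Unset Printing Implicit Defensive.

Import Order.TTheory GRing.Theory Num.Theory.
Import numFieldNormedType.Exports.

Local Open Scope classical_set_scope.
Local Open Scope ring_scope.
Local Open Scope complex_scope.

Definition separable_space (T : topologicalType) : Prop :=
  exists2 D : set T, countable D & dense D.

(* A partially defined map of H: only the values of [op_fun] on [dom] are
   meaningful, and [op_eq] below is the equality that ignores the others.
   No linearity is built in, so that the class contains the compositions of
   linear and antilinear maps. *)
Record operator (H : Type) := Operator {
  dom : set H;
  op_fun :> H -> H
}.

Section Operators.
Context {H : Type}.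
Implicit Types S T : operator H.

Definition op_eq S T : Prop :=
  dom S = dom T /\ forall x, dom S x -> S x = T x.

Definition total_op (f : H -> H) : operator H := Operator setT f.

Definition op_comp S T : operator H :=
  Operator [set x | dom T x /\ dom S (T x)] (S \o T).

End Operators.

Section Hilbert.
Context {R : realType} {H : completeNormedModType R[i]}.
(* [ip] is linear in its first argument and antilinear in the second. *)
Variable ip : {dot H for (@Num.conj R[i])}.
Implicit Types (S T A : operator H) (U C J f : H -> H) (M : set H).

(* Together with the completeness of H, this makes (H, ip) a Hilbert space. *)
Definition norm_from_dot : Prop := forall x : H, `|x| ^+ 2 = ip x x.

Definition ker_op T : set H := [set x | dom T x /\ T x = 0].

Definition orthocompl M : set H := [set y | forall x, M x -> ip x y = 0].

Definition bounded_map f : Prop :=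
  exists K : R, forall x, `|f x| <= K%:C * `|x|.

Definition antilinear f : Prop := GRing.linear_for (Num.conj \; *:%R) f.

Definition linear_op T : Prop :=
  dom T 0 /\
  forall (a : R[i]) (x y : H), dom T x -> dom T y ->
    dom T (a *: x + y) /\ T (a *: x + y) = a *: T x + T y.

Definition densely_defined T : Prop := dense (dom T).

(* When T is densely defined, the z below is unique. *)
Definition adjoint T : operator H :=
  let adj y := [set z : H | forall x, dom T x -> ip (T x) y = ip x z] in
  Operator [set y | adj y !=set0] (fun y => xget 0 (adj y)).

(* In R[i], [0 <= z] means that z is real and nonnegative. *)
Definition positive_selfadjoint A : Prop :=
  [/\ linear_op A, densely_defined A, op_eq A (adjoint A)
    & forall x, dom A x -> 0 <= ip (A x) x].

Definition is_modulus T A : Prop :=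
  positive_selfadjoint A /\ op_eq (op_comp A A) (op_comp (adjoint T) T).

Definition partial_isometry U : Prop :=
  [/\ linear U, bounded_map U
    & forall x, orthocompl (ker_op (total_op U)) x -> `|U x| = `|x|].

Definition is_polar_decomposition T U A : Prop :=
  [/\ is_modulus T A, partial_isometry U, ker_op (total_op U) = ker_op T
    & op_eq T (op_comp (total_op U) A)].

Definition conjugation_on M C : Prop :=
  [/\ forall (a : R[i]) x y, M x -> M y ->
        C (a *: x + y) = Num.conj a *: C x + C y,
      forall x, M x -> M (C x),
      forall x, M x -> C (C x) = x
    & forall x y, M x -> M y -> ip (C x) (C y) = ip y x].

Definition conjugation C : Prop := conjugation_on setT C.

Definition partial_conjugation J : Prop :=
  [/\ antilinear J, bounded_map J
    & conjugation_on (orthocompl (ker_op (total_op J))) J].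

Definition C_selfadjoint C T : Prop :=
  [/\ linear_op T, densely_defined T
    & op_eq T (op_comp (total_op C) (op_comp (adjoint T) (total_op C)))].

End Hilbert.

(* Main.v *)
(* Put [J = CU], so that [J|T| = CT]. Since [T = CT*C], the antilinear operator
   [S = CT] is symmetric for the real inner product [Re <_, _>] and
   [S^2 = T*T = |T|^2]. The bounded operators [F = |T|(1 + |T|^2)^-1] and
   [G = S(1 + |T|^2)^-1] are symmetric, [F >= 0] and [G^2 = F^2], which forces
   [FG = GF]. As [ker F + ran F] is dense and [G = JF], [J] commutes with [F] and
   with [(1 + |T|^2)^-1], hence with [|T|], and [J^2 F^2 = G^2 = F^2] gives
   [J^2 = 1] on the orthogonal complement of [ker T]. *)

Require Import Defs.
From mathcomp Require Import all_boot all_order all_algebra sesquilinear.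
From mathcomp Require Import all_classical all_reals all_analysis.
From mathcomp Require Import complex.
From mathcomp Require Import ring lra.

Import Order.TTheory GRing.Theory Num.Theory.
Import numFieldNormedType.Exports.
Local Open Scope ring_scope.
Local Open Scope complex_scope.

Set Implicit Arguments.
Unset Strict Implicit.
Unset Printing Implicit Defensive.

(** * Elementary tools and real inner products *)

Lemma ler0_eps (R : realType) (r K : R) :
  (forall e, 0 < e -> r <= e * K) -> r <= 0.
Proof.
move=> h; have [//|r0] := leP r 0; have [K0|K0] := leP K 0.
  by have := h 1 ltr01; lra.
(* This choice of [e] turns the bound into [r <= r / 2]. *)
have := h (r / (2 * K)); rewrite divr_gt0 ?mulr_gt0// => /(_ isT).
have -> : r / (2 * K) * K = r / 2 by field; rewrite gt_eqF.
lra.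
Qed.

Lemma morphD_0 (U V : zmodType) (f : U -> V) :
  {morph f : x y / x + y} -> f 0 = 0.
Proof.
by move=> fD; have /(congr1 (fun z => z - f 0)) := fD 0 0; rewrite addr0 addrK subrr.
Qed.

Lemma morphD_sub (U V : zmodType) (f : U -> V) :
  {morph f : x y / x + y} -> {morph f : x y / x - y}.
Proof.
by move=> fD x y; apply/eqP; rewrite eq_sym subr_eq -fD subrK.
Qed.

(* Only real scalars are used, so that linear and antilinear maps of a complex
   space can be treated alike. *)
Record real_inner (R : realType) (V : lmodType R[i]) (b : V -> V -> R) : Prop :=
  RealInner {
    innerC : forall x y, b x y = b y x;
    innerDl : forall x y z, b (x + y) z = b x z + b y z;
    innerZl : forall c x y, b (c%:C *: x) y = c * b x y;
    inner_ge0 : forall x, 0 <= b x x;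
    inner_eq0 : forall x, b x x = 0 -> x = 0 }.

(** * Cauchy-Schwarz, completeness and orthogonal projection *)

Section RealInner.
Context {R : realType} {V : lmodType R[i]} {b : V -> V -> R}.
Hypothesis hb : real_inner b.

Lemma innerDr x y z : b x (y + z) = b x y + b x z.
Proof. by rewrite innerC// innerDl// !(innerC hb _ x). Qed.

Lemma inner0l x : b 0 x = 0.
Proof. by have := innerDl hb 0 0 x; rewrite addr0; lra. Qed.

Lemma inner0r x : b x 0 = 0.
Proof. by rewrite innerC// inner0l. Qed.

Lemma innerNl x y : b (- x) y = - b x y.
Proof. by have := innerDl hb x (- x) y; rewrite subrr inner0l; lra. Qed.

Lemma innerNr x y : b x (- y) = - b x y.
Proof. by rewrite innerC// innerNl innerC. Qed.

Lemma innerZr c x y : b x (c%:C *: y) = c * b x y.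
Proof. by rewrite innerC// innerZl// innerC. Qed.

Definition innerE :=
  (innerDl hb, innerDr, innerNl, innerNr, innerZl hb, innerZr, inner0l, inner0r).

Lemma inner_inj x y : (forall z, b x z = b y z) -> x = y.
Proof.
move=> h; apply/eqP; rewrite -subr_eq0; apply/eqP/(inner_eq0 hb).
by rewrite innerDl// innerNl h subrr.
Qed.

Lemma innerD_sq x y : b (x + y) (x + y) = b x x + 2 * b x y + b y y.
Proof. by rewrite !innerE (innerC hb y x); ring. Qed.

Lemma innerB_sq x y : b (x - y) (x - y) = b x x - 2 * b x y + b y y.
Proof. by rewrite !innerE (innerC hb y x); ring. Qed.

Lemma inner_CS x y : b x y ^+ 2 <= b x x * b y y.
Proof.
have [y0|y0] := eqVneq (b y y) 0.
  by rewrite (inner_eq0 hb y0) !innerE expr0n mulr0.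
have yp : 0 < b y y by rewrite lt0r y0 inner_ge0.
have := inner_ge0 hb (x - (b x y / b y y)%:C *: y).
rewrite innerB_sq innerZr innerZl// innerZr.
have -> : b x x - 2 * (b x y / b y y * b x y) +
   b x y / b y y * (b x y / b y y * b y y)
  = (b x x * b y y - b x y ^+ 2) / b y y by field.
by rewrite pmulr_lge0 ?invr_gt0// subr_ge0.
Qed.

Lemma innerB_sqC x y : b (x - y) (x - y) = b (y - x) (y - x).
Proof. by rewrite -opprB !innerE; ring. Qed.

Lemma innerD_sq_le x y : b (x + y) (x + y) <= 2 * b x x + 2 * b y y.
Proof.
by have := inner_ge0 hb (x - y); rewrite innerB_sq innerD_sq; lra.
Qed.

(** Squared distances keep norms and topologies out of [V] and [V * V]. *)
Definition inner_complete := forall u : nat -> V,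
  (forall e, 0 < e -> exists N, forall m n, (N <= m)%N -> (N <= n)%N ->
     b (u m - u n) (u m - u n) < e) ->
  exists l, forall e, 0 < e -> exists N, forall n, (N <= n)%N ->
     b (u n - l) (u n - l) < e.

(** Membership in the closure of [M]; [e] bounds the squared distance. *)
Definition adherent (M : set V) (x : V) := forall e, 0 < e ->
  exists2 m, M m & b (x - m) (x - m) < e.

Lemma adherent_ortho (M : set V) x y :
  adherent M x -> (forall m, M m -> b m y = 0) -> b x y = 0.
Proof.
move=> Mx My; apply/eqP; rewrite -sqrf_eq0 eq_le sqr_ge0 andbT.
apply: (@ler0_eps _ _ (b y y)) => e e0.
have [m Mm xm] := Mx _ e0.
have -> : b x y = b (x - m) y by rewrite innerDl// innerNl (My _ Mm) subr0.
apply: (le_trans (inner_CS _ _)).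
by rewrite ler_wpM2r ?inner_ge0// ltW.
Qed.

(** A minimizing sequence for the distance to [M] is Cauchy. As [M] may fail to be closed, its limit
    [p] is only adherent to [M]. *)
Lemma projection (M : set V) : inner_complete ->
  M 0 -> (forall x y, M x -> M y -> M (x + y)) ->
  (forall c x, M x -> M (c%:C *: x)) ->
  forall x, exists2 p, adherent M p & forall m, M m -> b m (x - p) = 0.
Proof.
move=> cpl M0 MD MZ x.
pose dist m := b (x - m) (x - m).
pose E : set R := [set r | exists2 m, M m & r = dist m]%classic.
have hE : has_inf E.
  split; first by exists (dist 0), 0.
  by exists 0 => _ [m _ ->]; exact: inner_ge0.
pose d := inf E.
have dle m : M m -> d <= dist m by move=> Mm; apply: ge_inf; [case: hE|exists m].
have /choice[u uP] : forall n : nat, exists m, M m /\ dist m < d + n.+1%:R^-1.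
  move=> n; have n0 : 0 < n.+1%:R^-1 :> R by rewrite invr_gt0.
  by have [_ [m Mm ->] ?] := inf_adherent n0 hE; exists m.
have small (e : R) : 0 < e -> exists N, forall n, (N <= n)%N -> dist (u n) < d + e.
  move=> e0; exists (Num.truncn e^-1) => n Nn; have [_ /lt_le_trans] := uP n; apply.
  rewrite lerD2l -[leRHS]invrK lef_pV2 ?posrE ?invr_gt0//.
  by apply/ltW/(lt_le_trans (truncnS_gt _)); rewrite ler_nat.
(* Parallelogram law: the midpoint of [u m] and [u n] lies in [M], so its squared distance to [x] is
   at least [d]. *)
have near m n : b (u m - u n) (u m - u n) <=
    2 * (dist (u m) - d) + 2 * (dist (u n) - d).
  have := dle ((2^-1)%:C *: (u m + u n)).
  rewrite /dist => /(_ (MZ _ _ (MD _ _ (proj1 (uP m)) (proj1 (uP n))))).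
  rewrite !innerB_sq !innerE (innerC hb (u n) (u m)); lra.
have [e e0|p up] := cpl u.
  have [N hN] := small (e / 4) ltac:(lra).
  by exists N => m n /hN ? /hN ?; apply: (le_lt_trans (near m n)); lra.
have Mp : adherent M p.
  move=> e /up[N /(_ N (leqnn N))]; rewrite innerB_sqC.
  by exists (u N) => //; case: (uP N).
exists p => // m Mm.
have um (e : R) : 0 < e -> exists N, forall n, (N <= n)%N ->
    b (x - u n) m ^+ 2 <= e * b m m.
  move=> /small[N hN]; exists N => n /hN un.
  have [m0|m0] := eqVneq (b m m) 0.
    by rewrite (inner_eq0 hb m0) !innerE expr0n mulr0.
  have mp : 0 < b m m by rewrite lt0r m0 inner_ge0.
  (* [t] minimizes the squared distance from [x] to [u n + t m], which is still at least [d]. *)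
  pose t := b (x - u n) m / b m m.
  have := dle _ (MD _ _ (proj1 (uP n)) (MZ t _ Mm)).
  rewrite /dist opprD addrA innerB_sq innerZr innerZl// innerZr.
  have -> : t * (t * b m m) = b (x - u n) m ^+ 2 / b m m.
    by rewrite /t; field.
  have -> : t * b (x - u n) m = b (x - u n) m ^+ 2 / b m m.
    by rewrite /t; field.
  rewrite -ler_pdivrMr//; move: un; rewrite /dist; lra.
apply/eqP; rewrite -sqrf_eq0 eq_le sqr_ge0 andbT.
(* The 4 comes from [(r + s)^2 <= 2 r^2 + 2 s^2], both squares being at most [e * b m m]. *)
apply: (@ler0_eps _ _ (4 * b m m)) => e e0.
have [N1 h1] := um _ e0; have [N2 h2] := up _ e0.
have := h1 _ (leq_maxl N1 N2); have := h2 _ (leq_maxr N1 N2).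
set v := u _ => vp xv.
have vpm : b (v - p) m ^+ 2 <= e * b m m.
  apply: (le_trans (inner_CS _ _)).
  by rewrite ler_wpM2r ?inner_ge0// ltW.
have -> : b m (x - p) = b (x - v) m + b (v - p) m.
  by rewrite -innerDl// addrA subrK innerC.
have := sqr_ge0 (b (x - v) m - b (v - p) m); nra.
Qed.

(** * Commutation of symmetric operators with equal squares, one of them positive *)

Section Commutation.
Variables F G : V -> V.
Hypotheses (FD : {morph F : x y / x + y}) (GD : {morph G : x y / x + y}).
Hypotheses (Fsym : forall x y, b (F x) y = b (F y) x)
           (Gsym : forall x y, b (G x) y = b (G y) x).
Hypotheses (F_ge0 : forall x, 0 <= b (F x) x)
           (F_le : forall x, 4 * b (F x) (F x) <= b x x).
Hypothesis GG : forall x, G (G x) = F (F x).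

Let X x := F (G x) - G (F x).
Let W x := x + X (X x).
Let q x := b (F x) x.

Lemma norm_eq_of_square x : b (G x) (G x) = b (F x) (F x).
Proof. by rewrite Gsym GG Fsym. Qed.

Let XD : {morph X : x y / x + y}.
Proof. by move=> x y; rewrite /X !(FD, GD) opprD addrACA. Qed.

Let X_anti x y : b (X x) y = - b (X y) x.
Proof.
rewrite /X !innerE !(Fsym (G _)) !(Gsym (F _)).
by rewrite (innerC hb (F y)) (innerC hb (G y)); ring.
Qed.

(** [F X + X F] is the commutator of [F^2 = G^2] with [G], which is zero. *)
Let FX x : F (X x) = - X (F x).
Proof.
by rewrite /X (morphD_sub FD) opprB -!GG.
Qed.

(** [F], and hence [G], has norm at most 1/2, so [F G] and [G F] have norm at most 1/4. *)
Let X_le x : 4 * b (X x) (X x) <= b x x.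
Proof.
have := innerD_sq_le (F (G x)) (- G (F x)); rewrite -/(X x) innerNl innerNr.
have := F_le (G x); have := F_le (F x); have := F_le x.
rewrite !norm_eq_of_square; lra.
Qed.

Let W_le x : b (W x) (W x) <= b x x.
Proof.
rewrite /W innerD_sq (innerC hb x) (X_anti (X x) x).
have := X_le (X x); have := inner_ge0 hb (X x); lra.
Qed.

Let q_le x : q x <= b x x.
Proof.
have := inner_ge0 hb (F x - x); rewrite innerB_sq.
have := F_le x; have := inner_ge0 hb x; rewrite /q; lra.
Qed.

(** Antisymmetry of [X] and [F X = - X F] turn the cross term [b (F x) (X (X x))] into [q (X x)]. *)
Let q_W x : q x + 2 * q (X x) <= q (W x).
Proof.
rewrite /q /W FD innerDl// !(innerDr _ x) (Fsym (X (X x)) x).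
rewrite (innerC hb (F x) (X (X x))) (X_anti (X x)).
have -> : - b (X (F x)) (X x) = b (F (X x)) (X x) by rewrite FX innerNl.
have := F_ge0 (X (X x)); lra.
Qed.

Let XW x : X (W x) = W (X x).
Proof. by rewrite /W XD. Qed.

(** Along the iterates of [W], [q] grows by at least [q (X x)] at each step, yet stays below
    [b x x]. *)
Let q_X x : q (X x) = 0.
Proof.
pose u n := iter n W x.
have uX n : q (X x) <= q (X (u n)).
  elim: n => //= n /le_trans; apply; rewrite XW.
  by have := q_W (X (u n)); have := F_ge0 (X (X (u n))); rewrite /q; lra.
have un n : b (u n) (u n) <= b x x by elim: n => //= n; apply/le_trans.
have qn n : n%:R * q (X x) <= q (u n).
  elim: n => [|n IH] /=; first by rewrite mul0r F_ge0.
  rewrite -natr1; have := q_W (u n); have := uX n.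
  have := F_ge0 (X x); rewrite -/(q _); lra.
apply/eqP; rewrite eq_le F_ge0 andbT.
apply: (@ler0_eps _ _ (b x x)) => e e0.
have e1 : e^-1 < (Num.truncn e^-1).+1%:R by exact: truncnS_gt.
set n := (Num.truncn e^-1).+1 in e1.
have := qn n; have := q_le (u n); have := un n; move=> h1 h2 h3.
have h4 : n%:R * q (X x) <= b x x by lra.
rewrite -ler_pdivrMl//; apply: le_trans h4.
by rewrite ler_wpM2r ?F_ge0// ltW.
Qed.

(* [X = FG - GF] anticommutes with [F], and [W = 1 + X^2] is a contraction that
   commutes with [X] and satisfies [q (W x) >= q x + 2 q (X x)]; since [q] is
   bounded, [q] vanishes on the range of [X], hence so do [F] and [X]. *)
Lemma commute_of_square x : F (G x) = G (F x).
Proof.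
have FX0 y : F (X y) = 0.
  apply: (inner_eq0 hb); have := q_X y; rewrite /q; move: (X y) => z qz.
  (* As [q z = 0], [q (z - F z) >= 0] reads [2 b (F z) (F z) <= q (F z)], while
     [q (F z) <= b (F z) (F z)]. *)
  have := F_ge0 (z - F z); have := q_le (F z); have := inner_ge0 hb (F z).
  rewrite /q (morphD_sub FD) !innerE qz (Fsym (F z) z); lra.
apply/eqP; rewrite -subr_eq0; apply/eqP/(inner_eq0 hb).
rewrite -/(X x) X_anti.
suff -> : X (X x) = 0 by rewrite inner0l oppr0.
have GX0 : G (X x) = 0.
  by apply: (inner_eq0 hb); rewrite norm_eq_of_square FX0 inner0l.
by rewrite {1}/X GX0 FX0 (morphD_0 FD) (morphD_0 GD) subrr.
Qed.

End Commutation.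

(** * Bounded maps, with constants for squared norms *)

Definition inner_bounded (f : V -> V) :=
  exists2 K, 0 <= K & forall x, b (f x) (f x) <= K * b x x.

Lemma inner_bounded_comp f g :
  inner_bounded f -> inner_bounded g -> inner_bounded (f \o g).
Proof.
move=> [K K0 fK] [L L0 gL]; exists (K * L); first exact: mulr_ge0.
by move=> x; apply: (le_trans (fK _)); rewrite -mulrA ler_wpM2l.
Qed.

Lemma inner_bounded_sub f g :
  inner_bounded f -> inner_bounded g -> inner_bounded (fun x => f x - g x).
Proof.
move=> [K K0 fK] [L L0 gL]; exists (2 * K + 2 * L); first by lra.
move=> x; apply: (le_trans (innerD_sq_le _ _)).
by rewrite innerNl innerNr opprK; have := fK x; have := gL x; lra.
Qed.

End RealInner.

Arguments inner_complete {R V} b.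
Arguments adherent {R V} b M x.
Arguments inner_bounded {R V} b f.

(** * The inner product on pairs, used for graphs of operators *)

Section GraphInner.
Context {R : realType} {V : lmodType R[i]} (b : V -> V -> R).

Definition graph_inner (p q : V * V) := b p.1 q.1 + b p.2 q.2.

Lemma graph_inner_real : real_inner b -> real_inner graph_inner.
Proof.
move=> hb; split=> [p q|p q r|c p q|p|[x y]]; rewrite /graph_inner /=.
- by rewrite !(innerC hb p.1) !(innerC hb p.2).
- by rewrite !(innerDl hb); ring.
- by rewrite !(innerZl hb); ring.
- by rewrite addr_ge0// inner_ge0.
- move/eqP; rewrite paddr_eq0 ?inner_ge0// => /andP[/eqP x0 /eqP y0].
  by rewrite (inner_eq0 hb x0) (inner_eq0 hb y0).
Qed.

Lemma graph_inner_complete :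
  real_inner b -> inner_complete b -> inner_complete graph_inner.
Proof.
move=> hb cpl u cu.
have [e e0|x xu] := cpl (fun n => (u n).1).
  have [N hN] := cu _ e0; exists N => m n mN nN.
  apply: le_lt_trans (hN _ _ mN nN).
  by rewrite /graph_inner /= lerDl inner_ge0.
have [e e0|y yu] := cpl (fun n => (u n).2).
  have [N hN] := cu _ e0; exists N => m n mN nN.
  apply: le_lt_trans (hN _ _ mN nN).
  by rewrite /graph_inner /= lerDr inner_ge0.
exists (x, y) => e e0.
have e2 : 0 < e / 2 by lra.
have [N1 h1] := xu _ e2; have [N2 h2] := yu _ e2.
exists (maxn N1 N2) => n; rewrite geq_max => /andP[/h1 + /h2].
rewrite /graph_inner /=; lra.
Qed.

End GraphInner.

(** * The bounded operators [(1 + A^2)^-1] and [A (1 + A^2)^-1] *)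

Section PositiveSelfadjoint.
Context {R : realType} {V : lmodType R[i]} {b : V -> V -> R}.
Hypotheses (hb : real_inner b) (b_complete : inner_complete b).
Variables (D : set V) (A : V -> V).
Hypotheses (D0 : D 0) (DD : forall x y, D x -> D y -> D (x + y))
           (DZ : forall c x, D x -> D (c%:C *: x)).
Hypotheses (AD : forall x y, D x -> D y -> A (x + y) = A x + A y)
           (AZ : forall c x, D x -> A (c%:C *: x) = c%:C *: A x).
(** [Amax] puts the adjoint relation of [A] for [b] inside the graph of [A]; with [Asym] this is
    selfadjointness. *)
Hypotheses (Asym : forall x y, D x -> D y -> b (A x) y = b (A y) x)
  (Amax : forall y z, (forall x, D x -> b (A x) y = b x z) -> D y /\ A y = z)
  (A_ge0 : forall x, D x -> 0 <= b (A x) x).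

Let A0 : A 0 = 0.
Proof. by have := AZ 0 D0; rewrite rmorph0 !scale0r. Qed.

(* [u] comes from projecting [(y, 0)] onto the graph of [A]. *)
Lemma one_plus_square_surj y : exists u, [/\ D u, D (A u) & u + A (A u) = y].
Proof.
have hg := graph_inner_real hb.
pose M : set (V * V) := [set p | D p.1 /\ p.2 = A p.1]%classic.
have [|||[p1 p2] Mp Mo] :=
    projection hg (graph_inner_complete hb b_complete) (M := M) _ _ _ (y, 0).
- by split.
- by move=> p q [? p2] [? q2]; split; rewrite /= ?AD ?p2 ?q2//; exact: DD.
- by move=> c p [? p2]; split; rewrite /= ?AZ ?p2//; exact: DZ.
(* The graph is closed: [(A x, - x)] is orthogonal to it, hence to the adherent point [(p1, p2)]. *)
have [Dp1 Ap1] : D p1 /\ A p1 = p2.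
  apply: Amax => x Dx.
  have := adherent_ortho hg (y := (A x, - x)) Mp.
  rewrite /graph_inner /= !(innerNr hb) => h; rewrite (innerC hb) (innerC hb x).
  apply/eqP; rewrite -subr_eq0; apply/eqP/h => -[m1 m2] [/= Dm ->].
  by rewrite (innerNr hb) (innerC hb m1) (Asym Dx Dm) subrr.
(* Orthogonality of [(y - p1, - p2)] to the graph reads [b (A x) p2 = b x (y - p1)]. *)
have [DA AA] : D p2 /\ A p2 = y - p1.
  apply: Amax => x Dx; have := Mo (x, A x) (conj Dx erefl).
  by rewrite /graph_inner /= sub0r (innerNr hb); lra.
by exists p1; rewrite Ap1 AA subrKC.
Qed.


(** By [Amax] the kernel of [A] is closed, so the projection onto its closure lies in it. *)
Lemma projection_ker x :
  exists n, [/\ D n, A n = 0 & forall z, D z -> A z = 0 -> b (x - n) z = 0].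
Proof.
pose N : set V := [set z | D z /\ A z = 0]%classic.
have [|||p Np Nx] := projection hb b_complete (M := N) _ _ _ x.
- by [].
- by move=> u v [Du u0] [Dv v0]; split; rewrite /= ?AD ?u0 ?v0 ?addr0//; exact: DD.
- by move=> c u [Du u0]; split; rewrite /= ?AZ ?u0 ?scaler0//; exact: DZ.
have [Dp Ap] : D p /\ A p = 0.
  apply: Amax => z Dz; rewrite (inner0r hb) (innerC hb).
  apply: (adherent_ortho hb Np) => m [Dm m0].
  by rewrite (innerC hb) Asym// m0 (inner0l hb).
by exists p; split=> // z Dz z0; rewrite (innerC hb) Nx.
Qed.

(** The resolvent [(1 + A^2)^-1]; [B_uniq] shows that the choice is forced. *)
Let B y := projT1 (cid (one_plus_square_surj y)).

Let BP y : [/\ D (B y), D (A (B y)) & B y + A (A (B y)) = y].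
Proof. by rewrite /B; case: cid. Qed.

Let DB y : D (B y). Proof. by case: (BP y). Qed.
Let DAB y : D (A (B y)). Proof. by case: (BP y). Qed.
Let BE y : B y + A (A (B y)) = y. Proof. by case: (BP y). Qed.
Let AAB y : A (A (B y)) = y - B y. Proof. by rewrite -{2}(BE y) addrAC subrr add0r. Qed.

Let DN x : D x -> D (- x).
Proof. by move=> /(DZ (-1)); rewrite rmorphN1 scaleN1r. Qed.

Let AN x : D x -> A (- x) = - A x.
Proof. by move=> /(AZ (-1)); rewrite rmorphN1 !scaleN1r. Qed.

Let AB x y : D x -> D y -> A (x - y) = A x - A y.
Proof. by move=> Dx Dy; rewrite AD ?AN//; exact: DN. Qed.

Let B_uniq u y : D u -> D (A u) -> u + A (A u) = y -> u = B y.
Proof.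
move=> Du DAu uy; have [Db Dab by_] := BP y.
apply/eqP; rewrite -subr_eq0; apply/eqP/(inner_eq0 hb).
set w := u - B y.
have Dw : D w by apply: DD => //; exact: DN.
have Aw : A w = A u - A (B y) by exact: AB.
have DAw : D (A w) by rewrite Aw; apply: DD => //; exact: DN.
have w0 : w + A (A w) = 0.
  by rewrite Aw AB// /w addrACA uy -opprD by_ subrr.
have : b (w + A (A w)) w = 0 by rewrite w0 (inner0l hb).
rewrite (innerDl hb) Asym//.
have := inner_ge0 hb w; have := inner_ge0 hb (A w); lra.
Qed.

Let BD : {morph B : x y / x + y}.
Proof.
move=> x y; symmetry; apply: B_uniq; first exact: DD.
  by rewrite AD//; exact: DD.
by rewrite !AD// addrACA !BE.
Qed.

Let BZ c x : B (c%:C *: x) = c%:C *: B x.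
Proof.
symmetry; apply: B_uniq; first exact: DZ.
  by rewrite AZ//; exact: DZ.
by rewrite !AZ// -scalerDr BE.
Qed.

Let BA x : D x -> B (A x) = A (B x).
Proof.
move=> Dx; symmetry; apply: B_uniq => //; rewrite AAB.
  by apply: DD => //; exact: DN.
by rewrite AB// subrKC.
Qed.

Let F x := A (B x).

Let FD : {morph F : x y / x + y}.
Proof. by move=> x y; rewrite /F BD AD. Qed.

(** Write the second argument as [v = B v + A (A (B v))] and use the symmetry of [A] in each
    term. *)
Let Fsym x y : b (F x) y = b (F y) x.
Proof.
have e u v : b (A (B u)) v = b (A (B u)) (B v) + b (A (B u)) (A (A (B v))).
  by rewrite -(innerDr hb) BE.
rewrite /F (e x y) (e y x) (Asym (DB x) (DB y)) (innerC hb (A (B x))).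
by rewrite (Asym (DAB y) (DAB x)) (innerC hb (A (A (B x)))).
Qed.

Let F_ge0 x : 0 <= b (F x) x.
Proof.
rewrite -{2}(BE x) (innerDr hb) addr_ge0//; first exact: A_ge0.
by rewrite (innerC hb); exact: A_ge0.
Qed.

(** With [c = A (A (B x))], [b x x = b (B x) (B x) + 2 b (F x) (F x) + b c c], and
    [b (B x - c) (B x - c) >= 0] bounds the outer terms below by [2 b (F x) (F x)]. *)
Let B_bounds x : 4 * b (F x) (F x) <= b x x /\ b (B x) (B x) <= b x x.
Proof.
have -> : b x x = b (B x + A (A (B x))) (B x + A (A (B x))) by rewrite BE.
rewrite (innerD_sq hb).
have -> : b (B x) (A (A (B x))) = b (F x) (F x) by rewrite (innerC hb) Asym.
have := inner_ge0 hb (B x - A (A (B x))); rewrite (innerB_sq hb).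
have -> : b (B x) (A (A (B x))) = b (F x) (F x) by rewrite (innerC hb) Asym.
have := inner_ge0 hb (F x); have := inner_ge0 hb (A (A (B x))); lra.
Qed.

Let F_ker n : D n -> A n = 0 -> F n = 0.
Proof.
move=> Dn n0; rewrite /F -BA// n0.
by rewrite (morphD_0 BD).
Qed.

Let ortho_ker x := forall z, D z -> A z = 0 -> b x z = 0.

(** The residual [q] of the projection onto the closure of the range has [F q = 0], so it lies in
    the kernel of [A] and is orthogonal to [x] and to [p]. *)
Let F_range x : ortho_ker x -> adherent b (range F) x.
Proof.
move=> xN.
have [|||p Fp Fx] := projection hb b_complete (M := range F) _ _ _ x.
- by exists 0; rewrite ?(morphD_0 FD).
- by move=> _ _ [u _ <-] [v _ <-]; exists (u + v).
- by move=> c _ [u _ <-]; exists (c%:C *: u); rewrite // /F BZ AZ.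
suff <- : p = x by [].
symmetry; apply/eqP; rewrite -subr_eq0; apply/eqP; set q := x - p.
have Fq : F q = 0.
  apply: (inner_inj hb) => z; rewrite (inner0l hb) Fsym.
  by apply: Fx; exists z.
have Bq : B q = q by rewrite -{2}(BE q) -/(F q) Fq A0 addr0.
have Dq : D q by rewrite -Bq.
have Aq : A q = 0 by rewrite -[in LHS]Bq.
apply: (inner_eq0 hb); rewrite {1}/q (innerDl hb) (innerNl hb) xN//.
by rewrite (adherent_ortho hb Fp) ?oppr0 ?addr0.
Qed.

Let vanish f : {morph f : x y / x + y} -> inner_bounded b f ->
  (forall y, f (F y) = 0) -> forall x, ortho_ker x -> f x = 0.
Proof.
move=> fD [K K0 fK] fF x /F_range xF; apply: (inner_eq0 hb); apply/eqP.
rewrite eq_le inner_ge0// andbT; apply: (@ler0_eps _ _ K) => e /xF[_ [y _ <-] xy].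
have -> : f x = f (x - F y) by rewrite (morphD_sub fD) fF subr0.
by apply: (le_trans (fK _)); rewrite mulrC ler_wpM2r// ltW.
Qed.

Let vanish_all f : {morph f : x y / x + y} -> inner_bounded b f ->
  (forall y, f (F y) = 0) -> (forall n, D n -> A n = 0 -> f n = 0) ->
  forall x, f x = 0.
Proof.
move=> fD fb fF fN x; have [n [Dn n0 xn]] := projection_ker x.
by rewrite -(subrK n x) fD (fN n)// (vanish fD fb)// addr0.
Qed.

(** * The factor [J] and its commutation with [A] *)

Variable J : V -> V.
Hypotheses (JD : {morph J : x y / x + y}) (J_bounded : inner_bounded b J)
  (J_ker : forall n, D n -> A n = 0 -> J n = 0).
(** [S = J A] will be [C T]; [JA_dom] and [JA_sq] together encode [S^2 = A^2] with domains. *)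
Hypothesis JA_sym : forall x y, D x -> D y -> b (J (A x)) y = b (J (A y)) x.
Hypothesis JA_dom : forall x, D x -> D (J (A x)) <-> D (A x).
Hypothesis JA_sq :
  forall x, D x -> D (A x) -> J (A (J (A x))) = A (A x).

(** With [S = J A], [u = S (B x)] solves [u + A (A u) = S x], because [S u = x - B x] and
    [A^2 u = S (S u)]. *)
Let BJA x : D x -> B (J (A x)) = J (A (B x)).
Proof.
move=> Dx.
have Du : D (J (A (B x))) by apply/JA_dom.
have Su : J (A (J (A (B x)))) = x - B x by rewrite JA_sq.
have DAu : D (A (J (A (B x)))).
  by apply/JA_dom; rewrite // Su; apply: DD => //; exact: DN.
symmetry; apply: B_uniq => //.
by rewrite -JA_sq// Su AB// (morphD_sub JD) subrKC.
Qed.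

Let G x := J (F x).

Let GG x : G (G x) = F (F x).
Proof. by rewrite /G /F BJA// JA_sq// -BA. Qed.

Let GD : {morph G : x y / x + y}.
Proof. by move=> x y; rewrite /G FD JD. Qed.

(** As for [F], expand by [1 = B + A^2 B], now with [A^2] rewritten as [(J A)^2]. *)
Let Gsym x y : b (G x) y = b (G y) x.
Proof.
have DG z : D (G z) by apply/JA_dom.
rewrite -{1}(BE y) -{2}(BE x) !(innerDr hb) /G /F JA_sym//; congr (_ + _).
rewrite -!JA_sq// -!/(F _) -!/(G _) (innerC hb (G x)) JA_sym//.
by rewrite (innerC hb).
Qed.

Let FG x : F (G x) = G (F x).
Proof.
by apply: (commute_of_square hb) => // y; case: (B_bounds y).
Qed.

Let F_bounded : inner_bounded b F.
Proof.
exists 1 => // x; have [] := B_bounds x.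
by have := inner_ge0 hb (F x); lra.
Qed.

Let B_bounded : inner_bounded b B.
Proof. by exists 1 => // x; rewrite mul1r; case: (B_bounds x). Qed.

(** On the range of [F] this is [G F = F G]; on the kernel of [A] both sides vanish. *)
Let JF x : J (F x) = F (J x).
Proof.
apply/eqP; rewrite -subr_eq0; apply/eqP; move: x.
apply: vanish_all.
- by move=> x y; rewrite !(FD, JD) opprD addrACA.
- by apply: inner_bounded_sub => //; apply: inner_bounded_comp.
- by move=> y; rewrite -!/(G _) FG subrr.
- by move=> n Dn n0; rewrite F_ker// (J_ker Dn n0) (morphD_0 JD) (morphD_0 FD) subrr.
Qed.

Let B_ker n : D n -> A n = 0 -> B n = n.
Proof. by move=> Dn n0; rewrite -{2}(BE n) -BA// n0 (morphD_0 BD) A0 addr0. Qed.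

(** On the range of [F] this reduces to [BJA]; on the kernel [B] is the identity and [J] is zero. *)
Let JB x : J (B x) = B (J x).
Proof.
apply/eqP; rewrite -subr_eq0; apply/eqP; move: x.
apply: vanish_all.
- by move=> x y; rewrite !(BD, JD) opprD addrACA.
- by apply: inner_bounded_sub => //; apply: inner_bounded_comp.
- by move=> y; rewrite BJA// /F BA// subrr.
- by move=> n Dn n0; rewrite B_ker// J_ker// (morphD_0 BD) subrr.
Qed.

(** Applying [J] to [x = B x + F (A x)] writes [J x] as a sum of two elements of [D]; then
    [A F = 1 - B] gives the value. *)
Let modulus_commute x : D x -> D (J x) /\ A (J x) = J (A x).
Proof.
move=> Dx; have Jx : J x = B (J x) + F (J (A x)).
  by rewrite -JB -JF -JD /F BA// BE.
have DJ : D (J x) by rewrite Jx; apply: DD; rewrite // /F.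
split=> //; rewrite Jx AD ?AAB//; last by rewrite /F.
by rewrite -/(F (J x)) -JF -JB BA// -/(F x) subrKC.
Qed.

(** Two density passes: [J^2 - 1] kills the range of [F^2] by [GG], hence the range of [F], hence
    the complement of the kernel. *)
Let involution_ortho_ker x :
  ortho_ker x -> J (J x) = x.
Proof.
move=> xN; apply/eqP; rewrite -subr_eq0; apply/eqP.
have JJD : {morph (fun y => J (J y) - y) : x y / x + y}.
  by move=> y z; rewrite !JD opprD addrACA.
have JJb : inner_bounded b (fun y => J (J y) - y).
  apply: inner_bounded_sub => //; first exact: inner_bounded_comp.
  by exists 1 => // y; rewrite mul1r.
apply: (vanish JJD JJb) => // y.
apply: (vanish_all (f := fun y => J (J (F y)) - F y)) => [u v|||n Dn n0].
- by rewrite FD; exact: JJD.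
- exact: (inner_bounded_comp JJb F_bounded).
- by move=> u; have := GG u; rewrite /G -JF => ->; rewrite subrr.
- by rewrite F_ker// !(morphD_0 JD) subrr.
Qed.

(** [J x] is adherent to the range of [G], which is orthogonal to the kernel as [G] is symmetric. *)
Let stable_ortho_ker x :
  ortho_ker x -> ortho_ker (J x).
Proof.
move=> /F_range xF z Dz z0; apply: (adherent_ortho hb (M := range G)); last first.
  by move=> _ [y _ <-]; rewrite Gsym /G F_ker// (morphD_0 JD) (inner0l hb).
have [K K0 JK] := J_bounded.
(* [K + 1] avoids a division by zero when [K = 0]. *)
move=> e e0; have [|_ [y _ <-] xy] := xF (e / (K + 1)).
  by rewrite divr_gt0//; lra.
exists (G y); first by exists y.
rewrite /G -(morphD_sub JD); apply: (le_lt_trans (JK _)).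
move: xy; rewrite ltr_pdivlMr; last by lra.
have := inner_ge0 hb (x - F y); nra.
Qed.

(** [J (J x)] differs from [x] by a kernel element, which lies in [D]. *)
Let dom_reflect x : D (J x) -> D x.
Proof.
move=> /modulus_commute[DJJ _]; have [n [Dn n0 xn]] := projection_ker x.
have := involution_ortho_ker xn; rewrite (morphD_sub JD) (J_ker Dn n0) subr0.
by move=> JJx; rewrite -(subrK n x) -JJx; exact: DD.
Qed.

(** The first two clauses amount to [J A = A J] with domains. *)
Lemma antilinear_polar :
  [/\ forall x, D x -> D (J x) /\ A (J x) = J (A x),
      forall x, D (J x) -> D x,
      forall x, ortho_ker x -> J (J x) = x
    & forall x, ortho_ker x -> ortho_ker (J x)].
Proof.
split; [exact: modulus_commute|exact: dom_reflect|
  exact: involution_ortho_ker|exact: stable_ortho_ker].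
Qed.

End PositiveSelfadjoint.

(** * The real part of the complex inner product *)

Section Hilbert.
Context {R : realType} {H : completeNormedModType R[i]}.
Variable ip : {dot H for (@Num.conj R[i])}.
Hypothesis ip_norm : norm_from_dot ip.

Definition re_ip (x y : H) : R := complex.Re (ip x y).

Lemma ReD (x y : R[i]) : complex.Re (x + y) = complex.Re x + complex.Re y.
Proof. by case: x y => [? ?] []. Qed.

Lemma Re_conj (x : R[i]) : complex.Re (Num.conj x) = complex.Re x.
Proof. by case: x. Qed.

Lemma ip_conj x y : ip x y = Num.conj (ip y x).
Proof. by rewrite hermitian_subproof expr0 mul1r. Qed.

Lemma re_ip_norm x : (re_ip x x)%:C = `|x| ^+ 2.
Proof.
by rewrite /re_ip -ip_norm RRe_real.
Qed.

Lemma re_ip_real : real_inner re_ip.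
Proof.
split=> [x y|x y z|c x y|x|x].
- by rewrite /re_ip ip_conj Re_conj.
- by rewrite /re_ip linearDl ReD.
- by rewrite /re_ip linearZl_LR /=; case: (ip x y) => u v /=; rewrite mul0r subr0.
- by rewrite -lecR re_ip_norm exprn_ge0.
- move=> x0; have := re_ip_norm x; rewrite x0 => /esym/eqP.
  by rewrite expf_eq0 /= normr_eq0 => /eqP.
Qed.

Lemma re_ip_lt (x : H) (e : R) : 0 < e -> (re_ip x x < e ^+ 2) = (`|x| < e%:C).
Proof.
move=> e0; rewrite -ltcR re_ip_norm rmorphXn/=.
by rewrite ltr_pXn2r// nnegrE// ler0c ltW.
Qed.

Lemma re_ip_complete : inner_complete re_ip.
Proof.
move=> u cu.
have : cauchy (u @ \oo)%classic.
  apply/cauchy_ballP => e e0.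
  (* Norms take values in [R[i]], where a positive element is real. *)
  have eE : e = (complex.Re e)%:C by rewrite RRe_real// gtr0_real.
  have r0 : 0 < complex.Re e by move: e0; rewrite eE ltcR.
  have [N hN] := cu _ (exprn_gt0 2 r0).
  exists (u @` [set n | (N <= n)%N], u @` [set n | (N <= n)%N])%classic => /=.
    by split; exists N => // n Nn; exists n.
  move=> [_ _] [/= [m Nm <-] [n Nn <-]]; rewrite -ball_normE /ball_ /= eE.
  by rewrite -re_ip_lt// hN.
move=> /cauchy_cvgP /cvg_ex[/= l /cvgrPdist_lt ul]; exists l => e e0.
have r0 : 0 < Num.sqrt e by rewrite sqrtr_gt0.
have [|N _ hN] := ul (Num.sqrt e)%:C; first by rewrite ltcR.
exists N => n /hN /=; rewrite -re_ip_lt// sqr_sqrtr ?ltW//.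
by rewrite -opprB /re_ip linearNl linearNr opprK.
Qed.

Lemma re_ip_i x y : re_ip x ('i%C *: y) = complex.Im (ip x y).
Proof.
rewrite /re_ip linearZr_LR /=; have -> : Num.conj 'i%C = - 'i%C :> R[i].
  by rewrite complexiE conjCi.
by case: (ip x y) => u v /=; simpc.
Qed.

(** By [re_ip_i] the second hypothesis compares imaginary parts. *)
Lemma ip_eqP x y x' y' : re_ip x y = re_ip x' y' ->
  re_ip x ('i%C *: y) = re_ip x' ('i%C *: y') -> ip x y = ip x' y'.
Proof.
rewrite !re_ip_i /re_ip.
by case: (ip x y) (ip x' y') => u v [u' v'] /= -> ->.
Qed.

Lemma dense_ortho (D : set H) z : dense D -> (forall x, D x -> ip x z = 0) -> z = 0.
Proof.
move=> dD zD; apply: (inner_eq0 re_ip_real).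
have Dz : adherent re_ip D z.
  move=> e e0; have r0 : 0 < Num.sqrt e by rewrite sqrtr_gt0.
  have rc : 0 < (Num.sqrt e)%:C :> R[i] by rewrite ltcR.
  have [||x [xz Dx]] := dD (ball z (Num.sqrt e)%:C).
  - by exists z; exact: ballxx.
  - exact: ball_open.
  exists x => //; move: xz; rewrite -ball_normE /ball_ /= -re_ip_lt//.
  by rewrite sqr_sqrtr ?ltW.
by apply: (adherent_ortho re_ip_real Dz) => x /zD; rewrite /re_ip => ->.
Qed.

Lemma re_ip_il x y : re_ip ('i%C *: x) y = - re_ip x ('i%C *: y).
Proof.
rewrite re_ip_i /re_ip linearZl_LR /=.
by case: (ip x y) => u v /=; simpc.
Qed.

Lemma linear_opP (T : operator H) : linear_op T ->
  [/\ dom T 0, T 0 = 0,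
     forall x y, dom T x -> dom T y -> dom T (x + y) /\ T (x + y) = T x + T y
   & forall a x, dom T x -> dom T (a *: x) /\ T (a *: x) = a *: T x].
Proof.
move=> [D0 Tlin].
have T0 : T 0 = 0.
  have [_] := Tlin 1 0 0 D0 D0.
  by rewrite !scale1r addr0 => /eqP; rewrite -subr_eq subrr eq_sym => /eqP.
split=> // [x y Dx Dy|a x Dx]; first by have := Tlin 1 x y Dx Dy; rewrite !scale1r.
by have := Tlin a x 0 Dx D0; rewrite T0 !addr0.
Qed.

Lemma adjointP (T : operator H) y : dom (adjoint ip T) y ->
  forall x, dom T x -> ip (T x) y = ip x (adjoint ip T y).
Proof. by move=> [z zP]; exact: (xgetI 0 zP). Qed.

(** Testing at ['i%C *: x] too upgrades the real identity to the complex one; density then makes the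
    adjoint value equal to [z]. *)
Lemma selfadjoint_max (A : operator H) : linear_op A -> densely_defined A ->
  op_eq A (adjoint ip A) -> forall y z,
  (forall x, dom A x -> re_ip (A x) y = re_ip x z) -> dom A y /\ A y = z.
Proof.
move=> /linear_opP[_ _ _ AZ] dA [domA AE] y z yz.
have ip_yz x : dom A x -> ip (A x) y = ip x z.
  move=> Dx; apply: ip_eqP; first exact: yz.
  have [Dix Aix] := AZ 'i%C x Dx.
  by rewrite -[LHS]opprK -[RHS]opprK -!re_ip_il -Aix yz.
have Dy : dom A y by rewrite domA; exists z.
split=> //; apply/eqP; rewrite -subr_eq0; apply/eqP/(dense_ortho dA) => x Dx.
rewrite linearBr /= -ip_yz// AE// -adjointP//; last by rewrite -domA.
by rewrite subrr.
Qed.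

End Hilbert.

(** * The partial conjugation [J = C U] *)

Theorem theorem8 (R : realType) (H : completeNormedModType R[i])
    (ip : {dot H for (@Num.conj R[i])})
    (ip_norm : norm_from_dot ip) (H_separable : separable_space H)
    (C : H -> H) (C_conj : conjugation ip C)
    (T : operator H) (T_sa : C_selfadjoint ip C T)
    (U : H -> H) (absT : operator H)
    (T_polar : is_polar_decomposition ip T U absT) :
  exists J : H -> H,
    [/\ partial_conjugation ip J,
        U = C \o J
      & op_eq (op_comp (total_op J) absT) (op_comp absT (total_op J))].
Proof.
case: C_conj => Clin _ /(_ _ Logic.I) CC /(_ _ _ Logic.I Logic.I) Cip.
have {}Clin a x y : C (a *: x + y) = Num.conj a *: C x + C y by exact: Clin.
case: T_sa => /linear_opP[D0 _ _ _] _ [domT TE].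
case: T_polar => -[[Alin dA Asa A_ge0] [domAA AAE]] [Ulin [K UK] Uiso] kerU [domU UE].
have rip := re_ip_real ip_norm.
have [_ A0 AD AZ] := linear_opP Alin.
have domE x : dom T x <-> dom absT x.
  by rewrite domU; split=> [[]|].
have TU x : dom absT x -> T x = U (absT x) by move=> /domE /UE.
(* [Tadj] and [adjT] read the C-selfadjointness of [T] in both directions, using [C^2 = 1]. *)
have Tadj y : dom T y -> dom (adjoint ip T) (C y) /\ T y = C (adjoint ip T (C y)).
  by move=> Dy; split; [move: Dy; rewrite domT => -[[]]|exact: TE].
have adjT z : dom (adjoint ip T) z -> dom T (C z) /\ T (C z) = C (adjoint ip T z).
  move=> Dz; have DCz : dom T (C z) by rewrite domT; split=> //; split=> //=; rewrite CC.
  by split=> //; rewrite TE//= CC.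
have CD x y : C (x + y) = C x + C y.
  by have := Clin 1 x y; rewrite rmorph1 !scale1r.
have C0 : C 0 = 0 by exact: morphD_0 CD.
have UD x y : U (x + y) = U x + U y.
  by have := Ulin 1 x y; rewrite !scale1r.
have U0 : U 0 = 0 by exact: morphD_0 UD.
pose J := C \o U.
have JA x : dom absT x -> J (absT x) = C (T x) by move=> /TU; rewrite /J /= => ->.
have JD : {morph J : x y / x + y} by move=> x y; rewrite /J /= UD CD.
have C_norm x : `|C x| = `|x|.
  by apply/eqP; rewrite -(eqrXn2 (n := 2))// !ip_norm Cip.
have J_bd : inner_bounded (re_ip ip) J.
  exists (K ^+ 2) => [|x]; first exact: sqr_ge0.
  rewrite -lecR rmorphM/= !re_ip_norm// rmorphXn/= -exprMn C_norm.
  by rewrite lerXn2r// nnegrE// (le_trans _ (UK x)).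
have AA_dom x : dom absT x -> dom absT (absT x) <-> dom (adjoint ip T) (T x).
  move=> Dx; move/seteqP: domAA => [h1 h2]; split=> h.
    by have [] := h1 x (conj Dx h).
  by have [] := h2 x (conj ((domE x).2 Dx) h).
have J_ker n : dom absT n -> absT n = 0 -> J n = 0.
  move=> Dn n0; have : ker_op T n by split; [exact/domE|rewrite TU// n0].
  by rewrite -kerU => -[_ /=]; rewrite /J /= => ->.
have JA_sym x y : dom absT x -> dom absT y ->
    re_ip ip (J (absT x)) y = re_ip ip (J (absT y)) x.
  (* [Re <C T x, y>] becomes [Re <C y, T x>], and [C T y] is the adjoint of [T] at [C y]. *)
  move=> Dx Dy; rewrite !JA// -{1}(CC y) /re_ip Cip -!/(re_ip _ _ _).
  have [DCy ->] := Tadj y ((domE y).2 Dy); rewrite CC.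
  rewrite (innerC rip) [RHS](innerC rip) /re_ip adjointP//.
  exact/domE.
have JA_dom x : dom absT x -> dom absT (J (absT x)) <-> dom absT (absT x).
  move=> Dx; rewrite JA// AA_dom// -domE; split=> [/Tadj[]|/adjT[]//].
  by rewrite CC.
have JA_sq x : dom absT x -> dom absT (absT x) ->
    J (absT (J (absT x))) = absT (absT x).
  move=> Dx DAx; have /adjT[DCT TCT] := (AA_dom x Dx).1 DAx.
  rewrite JA; last exact/JA_dom.
  by rewrite JA// TCT CC; exact/esym/(AAE x (conj Dx DAx)).
have DD x y : dom absT x -> dom absT y -> dom absT (x + y).
  by move=> Dx Dy; have [] := AD x y Dx Dy.
have DZ c x : dom absT x -> dom absT (c%:C *: x) by move=> /(AZ c%:C)[].
have Asym x y : dom absT x -> dom absT y -> re_ip ip (absT x) y = re_ip ip (absT y) x.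
  case: Asa => domA AE Dx Dy; rewrite (innerC rip (absT y)).
  by rewrite /re_ip (AE y)// -adjointP// -domA.
have Are_ge0 x : dom absT x -> 0 <= re_ip ip (absT x) x.
  by move=> /A_ge0; rewrite lecE => /andP[].
have DA0 := (domE 0).1 D0.
have ADr x y Dx Dy := (AD x y Dx Dy).2.
have AZr (c : R) x Dx := (AZ c%:C x Dx).2.
have Amax := selfadjoint_max ip_norm Alin dA Asa.
have kerJ m : J m = 0 -> dom absT m /\ absT m = 0.
  move=> Jm; have Um : U m = 0 by rewrite -(CC (U m)) (Jm : C (U m) = 0) C0.
  have : ker_op (total_op U) m by [].
  rewrite kerU => -[/domE Dm Tm]; split=> //.
  (* [|absT m|^2 = <absT^2 m, m>], and [absT^2 m = J absT (J absT m)] vanishes. *)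
  have JAm : J (absT m) = 0 by rewrite JA// Tm C0.
  have DAm : dom absT (absT m) by apply/JA_dom; rewrite // JAm.
  apply: (inner_eq0 rip); rewrite Asym//.
  by rewrite -JA_sq// JAm A0 /J /= U0 C0 (inner0l rip).
have perp x : orthocompl ip (ker_op (total_op J)) x ->
    forall z, dom absT z -> absT z = 0 -> re_ip ip x z = 0.
  move=> xJ z Dz z0; rewrite (innerC rip) /re_ip xJ//.
  by split=> //; exact: J_ker.
have JZ a x : J (a *: x) = Num.conj a *: J x.
  have := Ulin a x 0; rewrite addr0 U0 addr0 /J /= => ->.
  by have := Clin a (U x) 0; rewrite C0 !addr0.
have [comm dom_refl JJ J_stable] := antilinear_polar rip (re_ip_complete ip_norm)
  DA0 DD DZ ADr AZr Asym Amax Are_ge0 JD J_bd J_ker JA_sym JA_dom JA_sq.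
exists J; split.
- split.
  + by move=> a x y; rewrite JD JZ.
  + by exists K => x; rewrite C_norm.
  (* [U] is isometric on the complement of its kernel, and that kernel lies in the kernel of [J]. *)
  + have J_norm x : orthocompl ip (ker_op (total_op J)) x ->
        re_ip ip (J x) (J x) = re_ip ip x x.
      move=> xJ; apply: complexI; rewrite !re_ip_norm// C_norm Uiso// => m [_ /= Um].
      by apply: xJ; split=> //=; rewrite /J /= Um.
    have J_re x y : orthocompl ip (ker_op (total_op J)) x ->
        orthocompl ip (ker_op (total_op J)) y ->
        re_ip ip (J x) (J y) = re_ip ip x y.
      move=> xJ yJ; have := J_norm (x + y).
      rewrite JD !(innerD_sq rip) !J_norm//.
      have xyJ : orthocompl ip (ker_op (total_op J)) (x + y).
        by move=> z Jz; rewrite linearDr /= xJ// yJ// addr0.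
      by move=> /(_ xyJ); lra.
    split=> [a x y _ _|x xJ m [_ /= Jm]|x xJ|x y xJ yJ].
    * by rewrite JD JZ.
    * have [Dm m0] := kerJ m Jm.
      have Jo := J_stable x (perp x xJ).
      (* Real orthogonality to [m] and to ['i%C *: m] gives complex orthogonality. *)
      have [Dim] := AZ 'i%C m Dm; rewrite m0 scaler0 => im0.
      suff Jxm : ip (J x) m = ip 0 0 by rewrite ip_conj Jxm linear0l rmorph0.
      by apply: ip_eqP; rewrite (inner0l rip) Jo.
    * exact/JJ/perp.
    * apply: ip_eqP; first by rewrite J_re// (innerC rip).
      have iyJ : orthocompl ip (ker_op (total_op J)) ('i%C *: y).
        by move=> z Jz; rewrite linearZr_LR /= yJ// mulr0.
      (* Imaginary parts come from [J_re] at ['i%C *: y]; antilinearity gives the sign that swaps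
         the arguments. *)
      rewrite -[RHS]opprK -re_ip_il (innerC rip _ x) -(J_re x)// JZ.
      by rewrite complexiE conjCi scaleNr (innerNr rip) opprK.
- by apply/funext => x; rewrite /J /= CC.
split; last by move=> x [/comm[_ /= ->]].
apply/seteqP; split=> [x [/comm[]]|x [_ /= DJx]] //; split=> //.
exact: dom_refl.
Qed.
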